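(* Let $a=b>0$ and let $T>0$ be arbitrary. Consider the Dirichlet-Neumann Waveform Relaxation (DNWR) iteration for the one-dimensional heat equation on $(-b,a)\times(0,T)$ with subdomains $\Omega_1=(-b,0)$ and $\Omega_2=(0,a)$, relaxation parameter $\theta$ and initial guess (error) $h^0\in L^\infty(0,T)$ on the interface $x=0$, as described in the context. Then for every $0<\theta<1$ the algorithm converges linearly. Moreover, for $\theta=1/2$ the algorithm converges to the exact solution in two iterations, independently of the size $T$ of the time window; that is, for every $T>0$ and every $h^0$, the second iterates $u_1^{2}$ and $u_2^{2}$ coincide with the exact solution on $\Omega_1\times(0,T)$ and $\Omega_2\times(0,T)$ respectively (in error form: $u_1^2\equiv 0$ and $u_2^2\equiv 0$).
   Context: Model problem: $\partial_t u=\partial_{xx}u+f(x,t)$ for $x\in(-b,a)$, $0<t<T$, with $u(x,0)=u_0(x)$, $u(-b,t)=g(-b,t)$, $u(a,t)=g(a,t)$, where $0<a,b<\infty$. DNWR algorithm with relaxation parameter $\theta\in(0,1]$: given an initial guess $h^0(t)$, $t\in(0,T)$, on the interface $\{x=0\}$, for $k=0,1,2,\dots$ solve first the Dirichlet problem $$\partial_t u_1^{k+1}-\partial_{xx}u_1^{k+1}=f \text{ in } \Omega_1=(-b,0),\quad u_1^{k+1}(x,0)=u_0(x),\quad u_1^{k+1}(-b,t)=g(-b,t),\quad u_1^{k+1}(0,t)=h^k(t),$$ then the problem $$\partial_t u_2^{k+1}-\partial_{xx}u_2^{k+1}=f \text{ in } \Omega_2=(0,a),\quad u_2^{k+1}(x,0)=u_0(x),\quad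 \partial_x u_2^{k+1}(0,t)=\partial_x u_1^{k+1}(0,t),\quad u_2^{k+1}(a,t)=g(a,t),$$ and update $h^{k+1}(t)=\theta u_2^{k+1}(0,t)+(1-\theta)h^k(t)$. Error convention: by linearity, convergence is studied for the errors, i.e. for the homogeneous iteration with $f=0$, $g=0$, $u_0=0$. The exact solution is then $0$, and $h^k$, $u_1^k$, $u_2^k$ denote the errors (so $h^k(t)$ is the error $h^k(t)-u(0,t)$ of the original iteration). Sense of solution: the homogeneous iteration is understood through the Laplace transform in time, $\hat w(s)=\int_0^\infty e^{-st}w(t)\,dt$, $\mathrm{Re}(s)>0$, with $h^0$ extended by zero to $(0,\infty)$ (the values on $(0,T)$ do not depend on the extension). That is, for $\mathrm{Re}(s)>0$, $\hat u_1^{k+1}(\cdot,s)$ solves $s\hat u_1=\partial_{xx}\hat u_1$ on $(-b,0)$ with $\hat u_1(-b,s)=0$, $\hat u_1(0,s)=\hat h^k(s)$; $\hat u_2^{k+1}(\cdot,s)$ solves $s\hat u_2=\partial_{xx}\hat u_2$ on $(0,a)$ with $\partial_x\hat u_2(0,s)=\partial_x\hat u_1^{k+1}(0,s)$, $\hat u_2(a,s)=0$; and $h^{k+1}$ is the function with Laplace transform $\hat h^{k+1}(s)=\theta\hat u_2^{k+1}(0,s)+(1-\theta)\hat h^k(s)$. ''Converges linearly'' means: there is a constant $\rho\in[0,1)$, independent of $k$ and $h^0$, such that $\|h^k\|_{L^\infty(0,T)}\le\rho^k\|h^0\|_{L^\infty(0,T)}$ for all $k\ge1$. *)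

(* Defs.v *)
From HB Require Import structures.
From mathcomp Require Import all_boot all_order all_algebra.
From mathcomp Require Import all_classical all_reals all_analysis.
From mathcomp Require Import complex.

Set Implicit Arguments.
Unset Strict Implicit.
Unset Printing Implicit Defensive.

Import Order.TTheory GRing.Theory Num.Theory numFieldNormedType.Exports.

Local Open Scope classical_set_scope.
Local Open Scope ring_scope.
Local Open Scope complex_scope.

Local Notation Re := complex.Re.
Local Notation Im := complex.Im.

Section LaplaceTransform.
Context {R : realType}.
Local Notation mu := (@lebesgue_measure R).

Definition cexp (z : R[i]) : R[i] :=
  (expR (Re z) * cos (Im z)) +i* (expR (Re z) * sin (Im z)).

(* [Rintegral] is total, so absolute convergence of the Laplace integral on the
   half-plane Re s > 0 is a separate condition; since |e^{-st}| = e^{-(Re s) t},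
   real exponents are enough.  Measurability is part of [integrable]. *)
Definition laplaceable (w : R -> R) : Prop :=
  forall sigma : R, 0 < sigma ->
    mu.-integrable `]0, +oo[ (fun t => (expR (- (sigma * t)) * w t)%:E).

Definition laplace (w : R -> R) (s : R[i]) : R[i] :=
  (\int[mu]_(t in `]0, +oo[) (Re (cexp (- (s * t%:C))) * w t)) +i*
  (\int[mu]_(t in `]0, +oo[) (Im (cexp (- (s * t%:C))) * w t)).

End LaplaceTransform.

(* R[i] carries no topology over R in the library; limits and derivatives of
   functions R -> R[i] of a real variable are taken componentwise. *)
Section ComplexValued.
Context {R : realType}.
Implicit Types (U : R -> R[i]) (s d : R[i]) (l r x : R).

Definition ccvg (F : set_system R) U d : Prop :=
  Re (U y) @[y --> F] --> Re d /\ Im (U y) @[y --> F] --> Im d.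

Definition ccontinuous_within (A : set R) U : Prop :=
  {within A, continuous (fun y => Re (U y))} /\
  {within A, continuous (fun y => Im (U y))}.

Definition cderivable U x : Prop :=
  derivable (fun y => Re (U y)) x 1 /\ derivable (fun y => Im (U y)) x 1.

Definition cderive U x : R[i] :=
  derive1 (fun y => Re (U y)) x +i* derive1 (fun y => Im (U y)) x.

Definition cdiffquot U x y : R[i] := (U y - U x) / (y - x)%:C.

Definition is_left_cderive U x d : Prop := ccvg (x^'-) (cdiffquot U x) d.

Definition is_right_cderive U x d : Prop := ccvg (x^'+) (cdiffquot U x) d.

(* Classical solution of s U = U'' on ]l, r[, continuous up to the end points
   so that boundary values make sense. *)
Definition solves_resolvent s l r U : Prop :=
  ccontinuous_within `[l, r] U /\
  forall x, x \in `]l, r[ ->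
    [/\ cderivable U x, cderivable (cderive U) x
      & s * U x = cderive (cderive U) x].

End ComplexValued.

Section DNWR.
Context {R : realType}.
Local Notation mu := (@lebesgue_measure R).

(* Error form of the iteration, i.e. with f = 0, g = 0, u_0 = 0, understood in
   the Laplace domain.  [u1 k x t] and [u2 k x t] are the subdomain iterates;
   they start at k = 1, so [u1 0] and [u2 0] are unconstrained. *)
Record dnwr (a b theta : R) (h0 : R -> R)
    (h : nat -> R -> R) (u1 u2 : nat -> R -> R -> R) : Prop := Dnwr {
  dnwr_init : h 0%N = h0;
  dnwr_h_laplaceable : forall k, laplaceable (h k);
  dnwr_u1_laplaceable : forall k (x : R), x \in `[- b, 0] -> laplaceable (u1 k.+1 x);
  dnwr_u2_laplaceable : forall k (x : R), x \in `[0, a] -> laplaceable (u2 k.+1 x);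
  dnwr_dirichlet : forall k (s : R[i]), 0 < Re s ->
    [/\ solves_resolvent s (- b) 0 (fun x => laplace (u1 k.+1 x) s),
        laplace (u1 k.+1 (- b)) s = 0
      & laplace (u1 k.+1 0) s = laplace (h k) s];
  dnwr_neumann : forall k (s : R[i]), 0 < Re s ->
    [/\ solves_resolvent s 0 a (fun x => laplace (u2 k.+1 x) s),
        laplace (u2 k.+1 a) s = 0
      & exists d : R[i],
          is_left_cderive (fun x => laplace (u1 k.+1 x) s) 0 d /\
          is_right_cderive (fun x => laplace (u2 k.+1 x) s) 0 d];
  dnwr_update : forall k (s : R[i]), 0 < Re s ->
    laplace (h k.+1) s =
      theta%:C * laplace (u2 k.+1 0) s + (1 - theta)%:C * laplace (h k) s
}.

Definition Linfty_norm (T : R) (w : R -> R) : \bar R :=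
  ('N[mu]_+oo[EFin \o (w \_ `]0%R, T[)])%E.

Definition in_Linfty (T : R) (w : R -> R) : Prop :=
  measurable_fun `]0, T[ w /\ (Linfty_norm T w < +oo)%E.

(* The initial error on ]0, T[ is extended by zero: [h0 \_ `]0, T[]. *)
Definition dnwr_converges_linearly (a b T theta : R) : Prop :=
  exists rho : R, 0 <= rho < 1 /\
    forall (h0 : R -> R) (h : nat -> R -> R) (u1 u2 : nat -> R -> R -> R),
      in_Linfty T h0 ->
      dnwr a b theta (h0 \_ `]0, T[) h u1 u2 ->
      forall k : nat, (1 <= k)%N ->
        (Linfty_norm T (h k) <= (rho ^+ k)%:E * Linfty_norm T h0)%E.

(* A time-dependent function is determined by its Laplace transform only up to
   null sets, so [u = 0] at a given x means: for almost every t. *)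
Definition dnwr_exact_after (n : nat) (a b T theta : R) : Prop :=
  forall (h0 : R -> R) (h : nat -> R -> R) (u1 u2 : nat -> R -> R -> R),
    in_Linfty T h0 ->
    dnwr a b theta (h0 \_ `]0, T[) h u1 u2 ->
    (forall x : R, x \in `]- b, 0[ ->
       {ae mu, forall t, t \in `]0, T[ -> u1 n x t = 0}) /\
    (forall x : R, x \in `]0, a[ ->
       {ae mu, forall t, t \in `]0, T[ -> u2 n x t = 0}).

End DNWR.

(* Main.v *)
(* For a = b the error of the Neumann subproblem is, in the Laplace domain, the
   odd reflection of the error of the Dirichlet subproblem: both solve
   s U = U'', vanish at the outer boundary, and have the same slope at 0.  Hence
   the Laplace transform of h^k is multiplied by 1 - 2 theta at each step; for
   theta = 1/2 it vanishes after one step, and with it the next subdomain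
   iterates.  Real s > 0 suffice, because a function w whose Laplace transform
   vanishes on the positive reals is 0 almost everywhere: the exponential
   polynomials (1 - e^{- n k t}) ^ (2 ^ n) with k = ln 2 / c converge boundedly to
   the indicator function of ]c, +oo[, so all tail integrals of e^{-t} w vanish,
   and w = 0 by Lebesgue differentiation. *)
Require Import Defs.
From mathcomp Require Import all_boot all_order all_algebra.
From mathcomp Require Import all_classical all_reals all_analysis.
From mathcomp Require Import complex measurable_realfun ess_sup_inf ring lra.

Import Order.TTheory GRing.Theory Num.Theory numFieldNormedType.Exports.
Local Open Scope classical_set_scope.
Local Open Scope ring_scope.

(** * Injectivity of the Laplace transform on the positive reals *)

Section Laplace.
Context {R : realType}.
Local Notation mu := (@lebesgue_measure R).

Definition real_laplace (w : R -> R) (s : R) : R :=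
  \int[mu]_(t in `]0, +oo[) (expR (- (s * t)) * w t).

(** Differences of tails show that the zero extension of [g] has vanishing integral over every []0,
    y]]; the derivative of this zero primitive is [g] almost everywhere by Lebesgue
    differentiation. *)
Lemma tails_eq0_ae (g : R -> R) :
  mu.-integrable `]0, +oo[ (EFin \o g) ->
  (forall c, 0 <= c -> \int[mu]_(t in `]c, +oo[) g t = 0) ->
  {ae mu, forall t, 0 < t -> g t = 0}.
Proof.
move=> gi g0.
pose f := g \_ `]0%R, +oo[.
have fi : mu.-integrable [set: R] (EFin \o f).
  by rewrite /f -restrict_EFin -integrable_mkcond.
have F0 (y : R) : \int[mu]_(t in `]0, y]) f t = 0.
  have [y0|y0] := leP y 0.
    by rewrite set_itv_ge ?Rintegral_set0// bnd_simp -leNgt.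
  have fg (c : R) : 0 <= c ->
      \int[mu]_(t in `]c, +oo[) f t = \int[mu]_(t in `]c, +oo[) g t.
    move=> c0; apply: eq_Rintegral => t; rewrite inE/= in_itv/= andbT => ct.
    by rewrite /f patchE mem_set//= in_itv/= andbT (le_lt_trans c0).
  have := @Rintegral_itvB R f (BRight 0) +oo%O y.
  rewrite !fg ?(ltW y0)// !g0 ?(ltW y0)// => /(_ _ _ _)/eqP.
  rewrite sub0r oppr_eq0 => /(_ _ _ _)/eqP; apply => //.
    by apply: integrableS fi.
  by rewrite bnd_simp ltW.
have fiy (y : R) : mu.-integrable [set` Interval (BRight 0) (BRight y)] (EFin \o f).
  by apply: integrableS fi.
have := @FTC1 R f (BRight 0) fiy (open_integrable_locally openT fi).
apply: filterS; first exact: (ae_filter_ringOfSetsType mu).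
move=> t + t0 => /(_ t0) [_].
rewrite (_ : (fun _ => _) = cst 0); last by apply/funext => y; exact: F0.
by rewrite derive1_cst /f patchE mem_set//= in_itv/= t0.
Qed.

Lemma bernoulli_inequality (y : R) m : 0 <= y <= 1 -> 1 - m%:R * y <= (1 - y) ^+ m.
Proof.
move=> /andP[y0 y1]; elim: m => [|m IH]; first by rewrite expr0; lra.
have := ler_wpM2l (_ : 0 <= 1 - y) IH; rewrite subr_ge0 => /(_ y1).
rewrite -exprS; apply: le_trans; rewrite -natr1.
have : 0 <= m%:R * (y * y) by rewrite !mulr_ge0.
lra.
Qed.

(** The threshold 1/2 comes from the exponent [2 ^ n]: Bernoulli bounds the term below by
    [1 - (2 * x) ^+ n]. *)
Lemma cvg_step_lt (x : R) : 0 <= x -> x < 1 / 2 ->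
  (1 - x ^+ n) ^+ (2 ^ n) @[n --> \oo] --> (1 : R).
Proof.
move=> x0 x2.
have x1 : x <= 1 by lra.
apply: (@squeeze_cvgr _ _ _ _ (fun n => 1 - (2 * x) ^+ n) (cst 1)).
- apply: nearW => n; have xn : 0 <= x ^+ n <= 1 by rewrite exprn_ge0//= exprn_ile1.
  apply/andP; split.
    by rewrite exprMn -natrX; exact: bernoulli_inequality.
  by case/andP: xn => xn0 xn1; rewrite exprn_ile1 ?subr_ge0 ?gerBl.
- rewrite -[X in _ --> X]subr0; apply: cvgB; first exact: cvg_cst.
  by apply: cvg_expr; rewrite ger0_norm; lra.
- exact: cvg_cst.
Qed.

(** Two uses of 1 + y <= e^y: first (1 - x^n)^(2^n) <= e^(-(2x)^n), then e^(-y) <= 1/y with y =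
    (2x)^n, which tends to infinity. *)
Lemma cvg_step_gt (x : R) : x <= 1 -> 1 / 2 < x ->
  (1 - x ^+ n) ^+ (2 ^ n) @[n --> \oo] --> (0 : R).
Proof.
move=> x1 x2.
apply: (@squeeze_cvgr _ _ _ _ (cst 0) (fun n => ((2 * x)^-1) ^+ n)).
- apply: nearW => n; have xn : 0 <= x ^+ n <= 1.
    by rewrite exprn_ge0 ?exprn_ile1//=; lra.
  case/andP: xn => xn0 xn1.
  rewrite exprn_ge0 ?subr_ge0//= (@le_trans _ _ (expR (- (2 * x) ^+ n)))//.
    rewrite exprMn -natrX mulrC -mulNr mulrC expRM_natl.
    rewrite lerXn2r ?nnegrE ?subr_ge0 ?expR_ge0//.
    exact: expR_ge1Dx.
  rewrite expRN exprVn lef_pV2 ?posrE ?expR_gt0 ?exprn_gt0//; last lra.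
  by rewrite (le_trans _ (expR_ge1Dx _))// lerDr.
- exact: cvg_cst.
- by apply: cvg_expr; rewrite ger0_norm ?invr_ge0 ?invf_lt1; lra.
Qed.

(* With k = n ln 2 / c and m = 2 ^ n the second factor tends to the indicator
   function of ]c, +oo[, while the kernel stays a finite combination of
   exponentials. *)
Definition laplace_kernel (s k : R) (m : nat) (t : R) : R :=
  expR (- (s * t)) * (1 - expR (- (k * t))) ^+ m.

(** One more factor 1 - e^(-kt) turns the kernel at [s] into the difference of the kernels at [s]
    and [s + k], so the induction must range over all [s]. *)
Lemma laplace_kernel_eq0 (w : R -> R) : laplaceable w ->
  (forall s, 0 < s -> real_laplace w s = 0) ->
  forall m s k, 0 < s -> 0 < k ->
    mu.-integrable `]0, +oo[ (fun t => (laplace_kernel s k m t * w t)%:E) /\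
    \int[mu]_(t in `]0, +oo[) (laplace_kernel s k m t * w t) = 0.
Proof.
move=> iw w0; elim=> [|m IH] s k s0 k0.
  have -> : laplace_kernel s k 0 = fun t => expR (- (s * t)).
    by apply/funext => t; rewrite /laplace_kernel expr0 mulr1.
  by split; [exact: iw|exact: w0].
have [i1 e1] := IH s k s0 k0.
have [i2 e2] := IH (s + k) k (addr_gt0 s0 k0) k0.
have E t : laplace_kernel s k m.+1 t * w t =
    laplace_kernel s k m t * w t - laplace_kernel (s + k) k m t * w t.
  by rewrite /laplace_kernel exprS (mulrDl s) opprD expRD; ring.
split; last by under eq_Rintegral do rewrite E; rewrite RintegralB// e1 e2 subrr.
have -> : (fun t => (laplace_kernel s k m.+1 t * w t)%:E) =
    ((fun t => (laplace_kernel s k m t * w t)%:E) \-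
     (fun t => (laplace_kernel (s + k) k m t * w t)%:E))%E.
  by apply/funext => t; rewrite E EFinB.
exact: integrableB.
Qed.

Lemma laplace_real_inj0 (w : R -> R) : laplaceable w ->
  (forall s, 0 < s -> real_laplace w s = 0) ->
  {ae mu, forall t, 0 < t -> w t = 0}.
Proof.
move=> iw w0.
(* The weight e^(-t) never vanishes and makes [w] integrable on the half-line. *)
pose g t := expR (- (1 * t)) * w t.
have gi : mu.-integrable `]0, +oo[ (EFin \o g) by apply: iw.
suff : {ae mu, forall t, 0 < t -> g t = 0}.
  apply: filterS; first exact: (ae_filter_ringOfSetsType mu).
  move=> t + t0 => /(_ t0)/eqP.
  by rewrite mulf_eq0 gt_eqF ?expR_gt0//= => /eqP.
(* The case c = 0 is the transform at s = 1 itself; it is split off because [k] below divides by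
   [c]. *)
apply: tails_eq0_ae => // c; rewrite le_eqVlt => /predU1P[<-|c0]; first exact: w0.
(* With this choice e^(-kt) crosses the threshold 1/2 exactly at t = c. *)
pose k := ln 2 / c.
have ln2 : 0 < ln 2 :> R by rewrite ln_gt0// ltr1n.
have k0 : 0 < k by rewrite divr_gt0.
pose f n t := laplace_kernel 1 (k * n%:R) (2 ^ n) t * w t.
have expk (n : nat) (t : R) : expR (- (k * n%:R * t)) = expR (- (k * t)) ^+ n.
  by rewrite -expRM_natl; congr expR; ring.
have expkc : expR (- (k * c)) = 1 / 2.
  by rewrite /k divfK ?gt_eqF// expRN lnK ?posrE// div1r.
have fi n : (0 < n)%N -> mu.-integrable `]0, +oo[ (EFin \o f n) /\
    \int[mu]_(t in `]0, +oo[) f n t = 0.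
  by move=> n0; apply: laplace_kernel_eq0 => //; rewrite mulr_gt0// ltr0n.
(* The sequence starts at index 1, since the kernel lemma asks for a positive rate [k * n%:R]. *)
have := @dominated_convergence _ _ R mu `]0, +oo[ (measurable_itv _)
  (fun n => EFin \o f n.+1) (EFin \o (g \_ `]c, +oo[)) (fun t => `|(g t)%:E|%E).
case.
- by move=> n; apply: measurable_int (fi n.+1 _).1.
- apply/measurable_EFinP; apply/measurable_restrict => //.
  have /integrableP[/measurable_EFinP mg _] := gi.
  apply: measurable_funS mg => //.
(* At t = c the second factor tends to 1/e, neither 0 nor 1; this single point is a null set. *)
- have : {ae mu, forall t, t != c}.
    exists [set c]; split => //=; first exact: lebesgue_measure_set1.
    by move=> t /= /negP; rewrite negbK => /eqP.
  apply: filterS; first exact: (ae_filter_ringOfSetsType mu).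
  move=> t tc /=; rewrite in_itv/= andbT => t0.
  apply: cvg_EFin; first exact: nearW.
  rewrite (_ : _ \o _ =
      fun n => (1 - expR (- (k * t)) ^+ n.+1) ^+ (2 ^ n.+1) * g t); last first.
    by apply/funext => n; rewrite /= /f /laplace_kernel expk /g; ring.
  rewrite (@cvg_shiftS _ (fun n => (1 - expR (- (k * t)) ^+ n) ^+ (2 ^ n) * g t)).
  have [ct|ct] := ltP c t.
    rewrite patchE mem_set/= ?in_itv/= ?ct//.
    have xlt : expR (- (k * t)) < 1 / 2 by rewrite -expkc ltr_expR ltrN2 ltr_pM2l.
    have cvg_g := cvgMr_tmp (b := g t) (cvg_step_lt _ (expR_ge0 _) xlt).
    by rewrite mul1r in cvg_g; exact: cvg_g.
  rewrite patchE memNset/= ?in_itv/= ?andbT; last by apply/negP; rewrite -leNgt.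
  have x1 : expR (- (k * t)) <= 1 by rewrite -expR0 ler_expR oppr_le0 mulr_ge0 ?ltW.
  have xgt : 1 / 2 < expR (- (k * t)).
    by rewrite -expkc ltr_expR ltrN2 ltr_pM2l// lt_neqAle tc.
  have cvg_g := cvgMr_tmp (b := g t) (cvg_step_gt _ x1 xgt).
  by rewrite mul0r in cvg_g; exact: cvg_g.
- exact: integrable_abse.
- apply: nearW => t n /=; rewrite in_itv/= andbT => t0.
  rewrite lee_fin /f /laplace_kernel mulrAC normrM -/(g t) ler_piMr//.
  have k_ge0 := ltW k0.
  have e0 : 0 < expR (- (k * n.+1%:R * t)) <= 1.
    by rewrite expR_gt0 -expR0 ler_expR oppr_le0 mulr_ge0 ?(ltW t0)// mulr_ge0.
  by rewrite ger0_norm ?exprn_ge0 ?exprn_ile1//; lra.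
- move=> _ _.
  have int0 n : (\int[mu]_(t in `]0%R, +oo[) (f n.+1 t)%:E = 0)%E.
    have [fin1 fin2] := fi n.+1 isT.
    by rewrite -(fineK (integrable_fin_num _ fin1))// [fine _]fin2.
  move=> /(cvg_lim (@ereal_hausdorff R)).
  rewrite (_ : (fun n => _) = cst 0%E); last by apply/funext => n; exact: int0.
  rewrite lim_cst; last exact: ereal_hausdorff.
  move=> e; rewrite /Rintegral.
  have -> : (\int[mu]_(t in `]c, +oo[) (g t)%:E =
      \int[mu]_(t in `]0%R, +oo[) ((g \_ `]c, +oo[) t)%:E)%E.
    have {1}-> : `]c, +oo[%classic =
        `]0, +oo[%classic `&` `]c, +oo[%classic :> set R.
      by rewrite setIidr//; apply: subset_itvr; rewrite bnd_simp ltW.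
    rewrite integral_mkcondr; apply: eq_integral => t _.
    by rewrite !patchE; case: ifP.
  by rewrite -e.
Qed.

Lemma laplace_real (w : R -> R) (s : R) :
  laplace w s%:C%C = (real_laplace w s)%:C%C.
Proof.
rewrite /laplace; congr (_ +i* _)%C.
  apply: eq_Rintegral => t _ /=.
  by rewrite !mul0r !mulr0 subr0 addr0 oppr0 cos0 mulr1.
rewrite (@eq_Rintegral _ _ _ _ _ (cst 0)) ?Rintegral_cst ?mul0r// => t _ /=.
by rewrite !(mulr0, mul0r) addr0 oppr0 sin0 mulr0 mul0r.
Qed.
End Laplace.

(** * Real solutions of k^2 u = u'' and their one-sided slopes at the interface *)

Section Ode.
Context {R : realType}.

Lemma is_derive0_itvoo_cst (f : R -> R) (l r x y : R) :
  (forall z, z \in `]l, r[ -> is_derive z 1 f 0) ->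
  x \in `]l, r[ -> y \in `]l, r[ -> f x = f y.
Proof.
move=> f0; wlog xy : x y / x <= y.
  by move=> H xlr ylr; case: (leP x y) => [|/ltW] ?; [|apply/esym]; exact: H.
rewrite !in_itv/= => /andP[lx xr] /andP[ly yr].
have xysub z : x <= z <= y -> is_derive z 1 f 0.
  move=> /andP[xz zy]; apply: f0.
  by rewrite in_itv/= (lt_le_trans lx)// (le_lt_trans zy).
have f0' z : z \in `]x, y[ -> is_derive z 1 f ((fun=> 0) z).
  by rewrite in_itv/= => /andP[xz zy]; apply: xysub; rewrite !ltW.
have fc : {within `[x, y], continuous f}.
  apply: derivable_within_continuous => z; rewrite in_itv/= => zxy.
  by have [] := xysub z zxy.
have [c _] := MVT_segment xy f0' fc.
by rewrite mul0r => /eqP; rewrite subr_eq0 => /eqP.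
Qed.

Lemma is_derive_expR_scale (c z : R) :
  is_derive z 1 (fun x => expR (c * x)) (c * expR (c * z)).
Proof.
rewrite [X in is_derive _ _ _ X](_ : _ = expR (c * z) * (c *: 1)).
  exact: is_derive1_comp.
by rewrite /GRing.scale /= mulr1 mulrC.
Qed.

Lemma resolvent_ode_oo (k l r : R) (u : R -> R) : 0 < k -> l < r ->
  (forall x, x \in `]l, r[ -> [/\ derivable u x 1, derivable (derive1 u) x 1
     & k ^+ 2 * u x = derive1 (derive1 u) x]) ->
  exists A B, forall x, x \in `]l, r[ ->
    u x = A * expR (k * x) + B * expR (- (k * x)).
Proof.
move=> k0 lr hu.
have cst (e : R) : e ^+ 2 = 1 -> exists C, forall x, x \in `]l, r[ ->
    derive1 u x - e * k * u x = C * expR (- (e * k) * x).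
  move=> e1.
  (* Factoring the equation as (d/dx + e k)(d/dx - e k) u = 0. *)
  pose f x := (derive1 u x - e * k * u x) * expR (e * k * x).
  have f0 z : z \in `]l, r[ -> is_derive z 1 f 0.
    move=> /hu [du ddu uE].
    have isu : is_derive z 1 u (derive1 u z) by rewrite derive1E; exact: derivableP.
    have isdu : is_derive z 1 (derive1 u) (derive1 (derive1 u) z).
      by rewrite [X in is_derive _ _ _ X]derive1E; exact: derivableP.
    have isf := is_deriveM (is_deriveB isdu (is_deriveZ (e * k) isu))
      (is_derive_expR_scale (e * k) z).
    apply: is_derive_eq isf _.
    rewrite -uE /GRing.scale /=.
    have -> : k ^+ 2 = (e * k) ^+ 2 by rewrite exprMn e1 mul1r.
    change ((derive1 u z - e * k * u z) * (e * k * expR (e * k * z)) +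
      expR (e * k * z) * ((e * k) ^+ 2 * u z - e * k * derive1 u z) = 0).
    by ring.
  (* Since [f] is constant, its value at the midpoint, an interior point, serves as the constant. *)
  exists (f ((l + r) / 2)) => x xlr.
  rewrite (is_derive0_itvoo_cst _ _ _ _ x f0) //; last by rewrite in_itv/=; lra.
  by rewrite /f mulNr expRN mulfK ?gt_eqF ?expR_gt0.
have [C hC] := cst 1 (expr1n _ _).
have e1 : (- 1) ^+ 2 = 1 :> R by rewrite sqrrN expr1n.
have [D hD] := cst (-1) e1.
(* Subtracting the relations for e = 1 and e = -1 eliminates u' and leaves 2 k u = D e^(kx) - C
   e^(-kx). *)
exists (D / (2 * k)), (- C / (2 * k)) => x xlr.
have hC' : derive1 u x - k * u x = C * expR (- (k * x)).
  by have := hC x xlr; rewrite !mul1r mulNr.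
have hD' : derive1 u x + k * u x = D * expR (k * x).
  by have := hD x xlr; rewrite !mulN1r !mulNr !opprK.
apply: (@mulfI _ (2 * k)); first by rewrite gt_eqF// mulr_gt0.
have -> : 2 * k * (D / (2 * k) * expR (k * x) + - C / (2 * k) * expR (- (k * x))) =
  D * expR (k * x) - C * expR (- (k * x)) by field; rewrite gt_eqF.
by rewrite -hC' -hD'; ring.
Qed.

Lemma cvg_sol (k A B x : R) :
  A * expR (k * y) + B * expR (- (k * y)) @[y --> x] -->
  A * expR (k * x) + B * expR (- (k * x)).
Proof.
have e_cont (c : R) : expR (c * y) @[y --> x] --> expR (c * x).
  by apply: continuous_comp; [exact: mulrl_continuous|exact: continuous_expR].
apply: cvgD; apply: cvgMl_tmp; first exact: e_cont.
by under eq_fun do rewrite -mulNr; rewrite -mulNr; exact: e_cont.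
Qed.

(** Both sides are continuous up to the end points, so uniqueness of one-sided limits extends the
    formula to where the boundary conditions are imposed. *)
Lemma resolvent_ode_cc (k l r : R) (u : R -> R) : 0 < k -> l < r ->
  {within `[l, r], continuous u} ->
  (forall x, x \in `]l, r[ -> [/\ derivable u x 1, derivable (derive1 u) x 1
     & k ^+ 2 * u x = derive1 (derive1 u) x]) ->
  exists A B, forall x, x \in `[l, r] ->
    u x = A * expR (k * x) + B * expR (- (k * x)).
Proof.
move=> k0 lr uc hu.
have [A [B hAB]] := resolvent_ode_oo _ _ _ _ k0 lr hu.
exists A, B => x.
move/continuous_within_itvP : uc => /(_ lr) [_ ul ur].
rewrite in_itv/= => /andP[]; rewrite le_eqVlt => /predU1P[<- _|lx].
  apply: (@cvg_unique _ (@Rhausdorff R) _ _ _ _ ul).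
  apply: cvg_trans (cvg_at_right_filter (cvg_sol k A B l)).
  apply: near_eq_cvg; near=> y; rewrite hAB// in_itv/=; apply/andP.
  by split; near: y; [exact: nbhs_right_gt|exact: nbhs_right_lt].
rewrite le_eqVlt => /predU1P[->|xr]; last by apply: hAB; rewrite in_itv/= lx.
apply: (@cvg_unique _ (@Rhausdorff R) _ _ _ _ ur).
apply: cvg_trans (cvg_at_left_filter (cvg_sol k A B r)).
apply: near_eq_cvg; near=> y; rewrite hAB// in_itv/=; apply/andP.
by split; near: y; [exact: nbhs_left_gt|exact: nbhs_left_lt].
Unshelve. all: by end_near. Qed.

Lemma is_derive_sol (k A B : R) :
  is_derive (0 : R) 1 (fun y : R => A * expR (k * y) + B * expR (- (k * y)))
    (k * (A - B)).
Proof.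
have -> : (fun y : R => A * expR (k * y) + B * expR (- (k * y))) =
    (fun y : R => A *: expR (k * y) + B *: expR (- k * y)).
  by apply/funext => y; rewrite mulNr.
have -> : k * (A - B) = A *: (k * expR (k * 0)) + B *: (- k * expR (- k * 0)).
  by rewrite !mulr0 expR0 /GRing.scale /=; ring.
by apply: is_deriveD; apply: is_deriveZ; exact: is_derive_expR_scale.
Qed.

Lemma Re_div_real (z : R[i]) (r : R) :
  complex.Re (z / r%:C%C) = complex.Re z / r.
Proof. by case: z => x y; rewrite -fmorphV /= mulr0 subr0. Qed.

Lemma ReB (z1 z2 : R[i]) : complex.Re (z1 - z2) = complex.Re z1 - complex.Re z2.
Proof. by case: z1 z2 => [? ?] [? ?]. Qed.

(** Each subdomain solution is known on one side of 0 only, whereas the exponential formula [e] is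
    differentiable at 0; restricting its derivative limit to [F] identifies the one-sided slope. *)
Lemma Re_cdiffquot_lim (F : set_system R) (U : R -> R[i]) (e : R -> R)
    (d : R[i]) (de : R) :
  ProperFilter F -> F `=>` 0^' -> is_derive (0 : R) 1 e de ->
  (\forall y \near F, complex.Re (U y) = e y) -> complex.Re (U 0) = e 0 ->
  ccvg F (cdiffquot U 0) d -> complex.Re d = de.
Proof.
move=> PF F0 [de0 <-] Ue U0 [Red _].
apply: (@cvg_unique _ (@Rhausdorff R) _ _ _ _ Red).
apply: cvg_trans (cvg_trans (cvg_app _ F0) de0).
apply: near_eq_cvg; near=> y.
rewrite /cdiffquot subr0 Re_div_real ReB U0 /GRing.scale /= addr0 mulr1 mulrC.
by congr ((_ - _) / _); apply/esym; near: y.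
Unshelve. all: by end_near. Qed.
End Ode.

(** * The iteration at real s > 0 and its consequences in time *)

Section Iteration.
Context {R : realType}.
Local Notation mu := (@lebesgue_measure R).
Local Notation Re := complex.Re.

Lemma Re_solves_resolvent (k l r : R) (U : R -> R[i]) : 0 < k -> l < r ->
  solves_resolvent (k ^+ 2)%:C%C l r U ->
  exists A B, forall x, x \in `[l, r] ->
    Re (U x) = A * expR (k * x) + B * expR (- (k * x)).
Proof.
move=> k0 lr [[Uc _] hU]; apply: resolvent_ode_cc => // x /hU [[dU _] [ddU _] UE].
split=> //; move: UE => /(congr1 (@complex.Re R)) /= <-.
by case: (U x) => p q /=; rewrite mul0r subr0.
Qed.

(** In exponential coefficients the odd reflection Re V(x) = -Re U(-x) reads C = -B, D = -A. *)
Lemma dnwr_real_interface (k a : R) (U V : R -> R[i]) : 0 < k -> 0 < a ->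
  solves_resolvent (k ^+ 2)%:C%C (- a) 0 U -> Re (U (- a)) = 0 ->
  solves_resolvent (k ^+ 2)%:C%C 0 a V -> Re (V a) = 0 ->
  (exists d, is_left_cderive U 0 d /\ is_right_cderive V 0 d) ->
  Re (V 0) = - Re (U 0) /\
  (Re (U 0) = 0 -> (forall x, x \in `[- a, 0] -> Re (U x) = 0) /\
                   (forall x, x \in `[0, a] -> Re (V x) = 0)).
Proof.
move=> k0 a0 hU Ua hV Va [d [dU dV]].
have Na0 : - a < 0 by rewrite oppr_lt0.
have [A [B UE]] := Re_solves_resolvent _ _ _ _ k0 Na0 hU.
have [C [D VE]] := Re_solves_resolvent _ _ _ _ k0 a0 hV.
have U0 : Re (U 0) = A * expR (k * 0) + B * expR (- (k * 0)).
  by apply: UE; rewrite in_itv/= lexx ltW.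
have V0 : Re (V 0) = C * expR (k * 0) + D * expR (- (k * 0)).
  by apply: VE; rewrite in_itv/= lexx ltW.
have dUE : Re d = k * (A - B).
  have E0 : \forall y \near 0^'-, Re (U y) = A * expR (k * y) + B * expR (- (k * y)).
    near=> y; apply: UE; rewrite in_itv/=; apply/andP.
    by split; near: y; [exact: nbhs_left_ge|exact: nbhs_left_le].
  have F0 : (0 : R)^'- `=>` 0^'.
    by apply: within_subset => z ?; rewrite lt_eqF.
  exact: (@Re_cdiffquot_lim _ _ U _ _ _ _ F0 (is_derive_sol k A B) E0 U0 dU).
have dVE : Re d = k * (C - D).
  have E0 : \forall y \near 0^'+, Re (V y) = C * expR (k * y) + D * expR (- (k * y)).
    near=> y; apply: VE; rewrite in_itv/=; apply/andP.
    by split; near: y; [exact: nbhs_right_ge|exact: nbhs_right_le].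
  have F0 : (0 : R)^'+ `=>` 0^'.
    by apply: within_subset => z ?; rewrite gt_eqF.
  exact: (@Re_cdiffquot_lim _ _ V _ _ _ _ F0 (is_derive_sol k C D) E0 V0 dV).
move: U0 V0; rewrite !mulr0 oppr0 expR0 !mulr1 => U0 V0.
(* The two exponentials take the values p, q at [a] and q, p at [- a]: this swap is where equal
   subdomain lengths enter. *)
set p := expR (k * a); set q := expR (- (k * a)).
have q0 : 0 < q by exact: expR_gt0.
have qp : q < p by rewrite ltr_expR gtrN// mulr_gt0.
have Uq : A * q + B * p = 0.
  have := UE (- a); rewrite Ua mulrN opprK => <- //.
  by rewrite in_itv/= lexx ltW.
have Vq : C * p + D * q = 0.
  have := VE a; rewrite Va => <- //.
  by rewrite in_itv/= lexx ltW.
have ABCD : A - B = C - D.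
  by apply: (@mulfI _ k); [rewrite gt_eqF|rewrite -dUE].
(* Adding the two outer boundary conditions and p times the slope condition isolates A + D, with
   factor p + q > 0. *)
have AD : A + D = 0.
  have /eqP : (A + D) * (p + q) = 0.
    have -> : (A + D) * (p + q) = (A * q + B * p) + (C * p + D * q) +
      p * ((A - B) - (C - D)) by ring.
    by rewrite Uq Vq ABCD; ring.
  by rewrite mulf_eq0 => /orP[/eqP//|]; rewrite gt_eqF//; lra.
have BC : B + C = 0 by lra.
split; first by rewrite U0 V0; lra.
rewrite U0 => AB.
(* Zero interface value means B = -A; the outer condition then gives A (q - p) = 0, and q < p. *)
have A0 : A = 0.
  have /eqP : A * (q - p) = 0.
    have -> : A * (q - p) = (A * q + B * p) - p * (A + B) by ring.
    by rewrite Uq AB; ring.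
  by rewrite mulf_eq0 => /orP[/eqP//|]; rewrite lt_eqF//; lra.
have B0 : B = 0 by lra.
have C0 : C = 0 by lra.
have D0 : D = 0 by lra.
by split=> x => [/UE|/VE] ->; rewrite ?A0 ?B0 ?C0 ?D0; ring.
Unshelve. all: by end_near. Qed.

Section Dnwr.
Variables (a theta : R) (h0 : R -> R) (h : nat -> R -> R).
Variables (u1 u2 : nat -> R -> R -> R).
Hypotheses (a0 : 0 < a) (H : dnwr a a theta h0 h u1 u2).

(** The Neumann trace at 0 is minus the Dirichlet trace, so the update yields -theta + (1 - theta) =
    1 - 2 theta. *)
Lemma dnwr_real_step n s : 0 < s ->
  real_laplace (h n.+1) s = (1 - 2 * theta) * real_laplace (h n) s /\
  (real_laplace (h n) s = 0 ->
    (forall x, x \in `[- a, 0] -> real_laplace (u1 n.+1 x) s = 0) /\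
    (forall x, x \in `[0, a] -> real_laplace (u2 n.+1 x) s = 0)).
Proof.
move=> s0.
have Res : 0 < Re s%:C%C by [].
have [hU Ua U0] := dnwr_dirichlet H n Res.
have [hV Va UV] := dnwr_neumann H n Res.
have hupd := dnwr_update H n Res.
(* The characteristic roots of s U = U'' are plus and minus the square root of [s]. *)
have k0 : 0 < Num.sqrt s by rewrite sqrtr_gt0.
have k2 : s = Num.sqrt s ^+ 2 by rewrite sqr_sqrtr// ltW.
rewrite k2 in hU hV Ua Va UV.
have Ua' := congr1 (@complex.Re R) Ua; have Va' := congr1 (@complex.Re R) Va.
have := dnwr_real_interface _ _ _ _ k0 a0 hU Ua' hV Va' UV.
rewrite -k2 U0.
have ReL w : Re (laplace w s%:C%C) = real_laplace w s by rewrite laplace_real.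
rewrite !ReL => -[V0 Z]; split.
  move: hupd; rewrite !laplace_real V0.
  move=> /(congr1 (@complex.Re R)) /= ->; ring.
move=> /Z [Z1 Z2]; split=> x.
  by move=> /Z1; rewrite ReL.
by move=> /Z2; rewrite ReL.
Qed.

Lemma dnwr_real_iterate n s : 0 < s ->
  real_laplace (h n) s = (1 - 2 * theta) ^+ n * real_laplace h0 s.
Proof.
move=> s0; elim: n => [|n IH]; first by rewrite expr0 mul1r (dnwr_init H).
by rewrite (dnwr_real_step n s s0).1 IH exprS mulrA.
Qed.

(** Injectivity is applied to the difference of both sides, whose real transform vanishes by
    linearity. *)
Lemma dnwr_h_ae n : {ae mu, forall t, 0 < t -> h n t = (1 - 2 * theta) ^+ n * h0 t}.
Proof.
set c := _ ^+ n.
have ih m s : 0 < s ->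
    mu.-integrable `]0, +oo[ (EFin \o (fun t => expR (- (s * t)) * h m t)).
  by move=> s0; apply: dnwr_h_laplaceable H m _ s0.
have h00 : h0 = h 0%N by rewrite (dnwr_init H).
have ich s : 0 < s ->
    mu.-integrable `]0, +oo[ (EFin \o (fun t => c * (expR (- (s * t)) * h0 t))).
  by move=> s0; rewrite h00; apply: (integrableZl _ c (ih 0%N s s0)).
have E s t : expR (- (s * t)) * (h n t - c * h0 t) =
    expR (- (s * t)) * h n t - c * (expR (- (s * t)) * h0 t) by ring.
have : {ae mu, forall t, 0 < t -> h n t - c * h0 t = 0}.
  apply: laplace_real_inj0.
    move=> s s0.
    have := integrableB _ (ih n s s0) (ich s s0).
    move=> /(_ (measurable_itv _)); congr (is_true (integrable _ _ _)).
    by apply/funext => t /=; rewrite E.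
  move=> s s0; rewrite /real_laplace; under eq_Rintegral do rewrite E.
  rewrite RintegralB//; [|exact: ih|exact: ich].
  rewrite RintegralZl//; last by rewrite h00; exact: ih.
  by rewrite -!/(real_laplace _ _) dnwr_real_iterate// subrr.
apply: filterS; first exact: (ae_filter_ringOfSetsType mu).
by move=> t ht t0; apply/eqP; rewrite -subr_eq0 ht.
Qed.

End Dnwr.

Lemma Linfty_norm_scale (T c : R) (f g : R -> R) :
  {ae mu, forall t, t \in `]0, T[ -> f t = c * g t} ->
  (Linfty_norm T f <= `|c|%:E * Linfty_norm T g)%E.
Proof.
(* The norm unfolds to an essential supremum, with default value 0 for a space of measure zero. *)
move=> fg; rewrite /Linfty_norm unlock; case: ifPn => _; last by rewrite mule0.
apply/ess_supP.
have := ess_sup_ge mu (abse \o (EFin \o g \_ `]0, T[)).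
apply: filterS2 fg; first exact: (ae_filter_ringOfSetsType mu).
move=> t fgt gt /=.
have -> : (f \_ `]0, T[) t = c * (g \_ `]0, T[) t.
  rewrite !patchE; case: ifPn => [|_]; last by rewrite /= mulr0.
  by rewrite inE => /fgt.
by rewrite normrM EFinM lee_wpmul2l.
Qed.
End Iteration.

Theorem theorem1 (R : realType) (a b T : R) (ha : 0 < a) (hab : a = b)
    (hT : 0 < T) :
  (forall theta : R, 0 < theta < 1 -> dnwr_converges_linearly a b T theta) /\
  dnwr_exact_after 2 a b T (1 / 2).
Proof.
rewrite -hab; split.
  (* The rate is the modulus of the multiplier, below 1 exactly when 0 < theta < 1. *)
  move=> theta /andP[theta0 theta1]; exists `|1 - 2 * theta|; split.
    by rewrite normr_ge0 ltr_norml; apply/andP; split; lra.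
  move=> h0 h u1 u2 _ H k _; rewrite -normrX; apply: Linfty_norm_scale.
  have := dnwr_h_ae _ _ _ _ _ _ ha H k.
  apply: filterS; first exact: (ae_filter_ringOfSetsType (@lebesgue_measure R)).
  move=> t ht tT; rewrite ht; last by move: tT; rewrite in_itv/= => /andP[].
  by rewrite patchE mem_set.
move=> h0 h u1 u2 _ H.
have h1 s : 0 < s -> real_laplace (h 1%N) s = 0.
  move=> s0; rewrite (dnwr_real_step _ _ _ _ _ _ ha H 0%N s s0).1.
  by rewrite mulrA (_ : _ - _ = 0) ?mul0r//; lra.
have ae0 w : laplaceable w -> (forall s, 0 < s -> real_laplace w s = 0) ->
    {ae (@lebesgue_measure R), forall t, t \in `]0, T[ -> w t = 0}.
  move=> iw w0; have := laplace_real_inj0 w iw w0.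
  apply: filterS; first exact: (ae_filter_ringOfSetsType (@lebesgue_measure R)).
  by move=> t + tT; apply; move: tT; rewrite in_itv/= => /andP[].
(* Step index 1 concerns the second subdomain iterates, which are driven by the vanishing [h 1]. *)
have U s (s0 : 0 < s) := (dnwr_real_step _ _ _ _ _ _ ha H 1%N s s0).2 (h1 s s0).
split=> x /subset_itv_oo_cc xa; apply: ae0.
- exact: dnwr_u1_laplaceable H 1%N x xa.
- by move=> s s0; apply: (U s s0).1.
- exact: dnwr_u2_laplaceable H 1%N x xa.
- by move=> s s0; apply: (U s s0).2.
Qed.
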